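(* (Progress) Let $(\mathcal M,\ge,\mathcal S)$ be a mode specification and consider the calculus Elevator over it, with its typing judgement $\Gamma\vdash e:A_k$, its evaluation relation $e\longrightarrow e'$ and its template reduction relations $e\rightsquigarrow^m e'$ ($m$ a mode). Then: (1) If $\Gamma\vdash e:A_k$, then either $e\longrightarrow e'$ for some $e'$, or $e$ is a weak normal form. (2) If $\Gamma\vdash e:A_k$, then (for a mode $m$) either $e\rightsquigarrow^m e'$ for some $e'$, or $e$ is a normal template in mode $m$.
   Context: **Modes.** A mode specification is a set $\mathcal M$ of modes with a preorder $\ge$ and a map $\mathcal S:\mathcal M\to\mathcal P(\{\mathtt C,\mathtt W\})$ ($\mathtt C$ = contraction, $\mathtt W$ = weakening) such that $m\ge k$ implies $\mathcal S(m)\supseteq\mathcal S(k)$. It is fixed globally. $k>j$ means $k\ge j$ and not $j\ge k$. Letters $k,l,m,n$ range over modes. **Syntax** (up to renaming of bound variables; subscripts are modes). Kinds $K_k::=\mathtt{Type}_k\mid[\Psi\vdash K_l]\uparrow^k_l$. Normal types $A_k,B_k::=\mathbf 1_k\mid P_k\mid\ulcorner\hat\Psi.A_l\urcorner\mid[\Psi\vdash A_l]\uparrow^k_l\mid A_n\downarrow^n_k\mid(\alpha{:}K_m)\to A_k\mid A_k\multimap B_k$. Neutral types $P_k,Q_k::=\alpha\mid\llcorner P_m\lrcorner@\sigma$. Terms $e,f::=x\mid\mathsf{one}\mid\ulcorner\hat\Psi.e\urcorner\mid\llcorner e\lrcorner@\sigma\mid\mathsf{store}(e)\mid\mathsf{load}(x)=e\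 \mathsf{in}\ f\mid\Lambda(\alpha{:}K_k).e\mid e\,A_k\mid\lambda(x{:}A_k).e\mid e\,f$. Contexts $\Gamma,\Delta,\Psi::=\cdot\mid\Gamma,\alpha{:}K_k\mid\Gamma,x{:}A_k$ (declared variables pairwise distinct). Substitutions $\sigma,\tau::=\cdot\mid\sigma,\alpha{\mapsto}A_k\mid\sigma,x{\mapsto_k}e$. $\hat\Psi$ is the list of variable names declared in $\Psi$; it binds these names in $\ulcorner\hat\Psi.-\urcorner$. **Context split.** $\Gamma_1\bowtie\Gamma_2=\Gamma$ is the ternary relation generated by: $\cdot\bowtie\cdot=\cdot$; and, whenever $\Gamma_1\bowtie\Gamma_2=\Gamma$: $(\Gamma_1,\alpha{:}K_k)\bowtie(\Gamma_2,\alpha{:}K_k)=\Gamma,\alpha{:}K_k$; $(\Gamma_1,\alpha{:}K_k)\bowtie\Gamma_2=\Gamma,\alpha{:}K_k$; $\Gamma_1\bowtie(\Gamma_2,\alpha{:}K_k)=\Gamma,\alpha{:}K_k$; $(\Gamma_1,x{:}A_k)\bowtie(\Gamma_2,x{:}A_k)=\Gamma,x{:}A_k$ if $\mathtt C\in\mathcal S(k)$; $(\Gamma_1,x{:}A_k)\bowtie\Gamma_2=\Gamma,x{:}A_k$; $\Gamma_1\bowtie(\Gamma_2,x{:}A_k)=\Gamma,x{:}A_k$. In a rule, $\Gamma_1\bowtie\Gamma_2$ denotes any context $\Gamma$ so related to $\Gamma_1,\Gamma_2$. **Hereditary substitution.** Dependency-free kinds $\kappa_k::=\mathtt{Type}_k\mid[\psi\vdash\kappa_l]\uparrow^k_l$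 and contexts $\psi,\gamma::=\cdot\mid\gamma,\alpha{:}\kappa_k\mid\gamma,x$. Erasure $(-)^-$ sends $\mathtt{Type}_k$ to itself, $[\Psi\vdash K_l]\uparrow^k_l$ to $[\Psi^-\vdash K_l^-]\uparrow^k_l$, and acts entrywise on contexts with $\alpha{:}K_k\mapsto\alpha{:}K_k^-$, $x{:}A_k\mapsto x$. The partial (capture-avoiding) operation $[\sigma]^\gamma(-)$ is homomorphic on all type, kind, context, substitution and term constructors (applied to every component) except for neutral types and term variables. On term variables: $[\sigma]^\gamma x=e$ if $x{\mapsto_k}e\in\sigma$, else $x$. On neutral types use the auxiliary $[\sigma]^\gamma_{\mathtt R}P$, returning either a type with a dependency-free kind, $A_k:\kappa_k$, or a neutral type $Q_k$: $[\sigma]^\gamma_{\mathtt R}\alpha=A_k:\kappa_k$ if $\alpha{\mapsto}A_k\in\sigma$ and $\alpha{:}\kappa_k\in\gamma$, otherwise $\alpha$; $[\sigma]^\gamma_{\mathtt R}(\llcorner P_m\lrcorner@\tau)=A'_k:\kappa_k$ if $[\sigma]^\gamma_{\mathtt R}P_m=\ulcorner\hat\Psi.A_k\urcorner:[\psi\vdash\kappa_k]\uparrow^m_k$, $[\sigma]^\gamma\tau=\tau'$ and $[\tau']^\psi A_k=A'_k$; and $=\llcorner P'_m\lrcorner@\tau'$ if $[\sigma]^\gamma_{\mathtt R}P_m=P'_m$ (neutral) and $[\sigma]^\gamma\tau=\tau'$; otherwise it fails. Then $[\sigma]^\gamma P_k$ is the type returned by $[\sigma]^\gamma_{\mathtt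 R}P_k$. **Well-formedness.** $\Gamma\ge k$ (resp. $k>\Gamma$) means every declaration in $\Gamma$ has a mode $\ge k$ (resp. $<k$); in a condition $k>\Psi\ge l$, $k\ge l$ is required also when $\Psi$ is empty. Presuppositions (a judgement is only considered when they hold): $\Gamma\vdash K_k\ \mathtt{kind}$ presupposes $\vdash\Gamma\ \mathtt{ctx}$ and $\Gamma\ge k$; $\Gamma\vdash A_k:K_k$ additionally presupposes $\Gamma\vdash K_k\ \mathtt{kind}$; $\Gamma\vdash e:A_k$ presupposes $\vdash\Gamma\ \mathtt{ctx}$, $\Gamma\ge k$, $\Gamma\vdash A_k:\mathtt{Type}_k$; $\Gamma\vdash\sigma:\Delta$ presupposes $\vdash\Gamma,\Delta\ \mathtt{ctx}$. Rules are written premises $\Rightarrow$ conclusion. Kinds: $\Rightarrow\Gamma\vdash\mathtt{Type}_k\ \mathtt{kind}$. $k>\Psi\ge l$, $\vdash\Gamma,\Psi\ \mathtt{ctx}$, $\Gamma,\Psi\vdash K_l\ \mathtt{kind}$ $\Rightarrow\Gamma\vdash[\Psi\vdash K_l]\uparrow^k_l\ \mathtt{kind}$. Types: - $\alpha{:}K_k\in\Gamma\Rightarrow\Gamma\vdash\alpha:K_k$. - $\Gamma,\Psi\vdash A_l:K_l\Rightarrow\Gamma\vdash\ulcorner\hat\Psi.A_l\urcorner:[\Psi\vdash K_l]\uparrow^k_l$. - $\Gamma_1\ge m$, $\vdash\Gamma_1\ \mathtt{ctx}$, $\vdash(\Gamma_1\bowtie\Gamma_2),\Psi\ \mathtt{ctx}$,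 $\Gamma_1\vdash[\Psi\vdash K_k]\uparrow^m_k\ \mathtt{kind}$, $\Gamma_1\vdash A_m:[\Psi\vdash K_k]\uparrow^m_k$, $\Gamma_1\bowtie\Gamma_2\vdash\sigma:\Psi$ $\Rightarrow\Gamma_1\bowtie\Gamma_2\vdash\llcorner A_m\lrcorner@\sigma:[\sigma]^{\Psi^-}K_k$ (with $A_m$ neutral). - $k>\Psi\ge l$, $\vdash\Gamma,\Psi\ \mathtt{ctx}$, $\Gamma,\Psi\vdash A_l:\mathtt{Type}_l$ $\Rightarrow\Gamma\vdash[\Psi\vdash A_l]\uparrow^k_l:\mathtt{Type}_k$. - $\Gamma_1\ge m\ge k$, $\vdash\Gamma_1\ \mathtt{ctx}$, $\Gamma_1\vdash A_m:\mathtt{Type}_m$ $\Rightarrow\Gamma_1\bowtie\Gamma_2\vdash A_m\downarrow^m_k:\mathtt{Type}_k$. - $\Gamma_1\ge m\ge k$, $\vdash\Gamma_1\ \mathtt{ctx}$, $\Gamma_1\vdash K_m\ \mathtt{kind}$, $(\Gamma_1\bowtie\Gamma_2),\alpha{:}K_m\vdash A_k:\mathtt{Type}_k$ $\Rightarrow\Gamma_1\bowtie\Gamma_2\vdash(\alpha{:}K_m)\to A_k:\mathtt{Type}_k$. - $\Gamma\vdash A_k:\mathtt{Type}_k$, $\Gamma\vdash B_k:\mathtt{Type}_k$ $\Rightarrow\Gamma\vdash A_k\multimap B_k:\mathtt{Type}_k$; and $\Rightarrow\Gamma\vdash\mathbf 1_k:\mathtt{Type}_k$. Contexts: $\Rightarrow\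 \vdash\cdot\ \mathtt{ctx}$. $\Gamma_1\ge k$, $\vdash\Gamma_1\ \mathtt{ctx}$, $\vdash\Gamma_1\bowtie\Gamma_2\ \mathtt{ctx}$, $\Gamma_1\vdash K_k\ \mathtt{kind}$ $\Rightarrow\ \vdash(\Gamma_1\bowtie\Gamma_2),\alpha{:}K_k\ \mathtt{ctx}$; likewise with $\Gamma_1\vdash A_k:\mathtt{Type}_k$ in place of the last premise $\Rightarrow\ \vdash(\Gamma_1\bowtie\Gamma_2),x{:}A_k\ \mathtt{ctx}$. **Typing of terms.** $\Gamma_W$ denotes any context all of whose term-variable entries have modes $j$ with $\mathtt W\in\mathcal S(j)$ (type variables are unrestricted). - $\Rightarrow(x{:}A_k)\bowtie\Gamma_W\vdash x:A_k$; $\ \Rightarrow\Gamma_W\vdash\mathsf{one}:\mathbf 1_k$. - $\Gamma,\Psi\vdash e:A_l\Rightarrow\Gamma\vdash\ulcorner\hat\Psi.e\urcorner:[\Psi\vdash A_l]\uparrow^k_l$. - $\vdash\Gamma_1\ \mathtt{ctx}$, $\Gamma_1\ge m$, $\vdash\Gamma_2,\Psi\ \mathtt{ctx}$, $\Gamma_1\vdash[\Psi\vdash A_k]\uparrow^m_k:\mathtt{Type}_m$, $\Gamma_1\vdash e:[\Psi\vdash A_k]\uparrow^m_k$, $\Gamma_2\vdash\sigma:\Psi$ $\Rightarrow\Gamma_1\bowtie\Gamma_2\vdash\llcorner e\lrcorner@\sigma:[\sigma]^{\Psi^-}A_k$. - $\Gamma\ge m$, $\vdash\Gamma\ \mathtt{ctx}$,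 $\Gamma\vdash e:A_m$ $\Rightarrow\Gamma\bowtie\Gamma_W\vdash\mathsf{store}(e):A_m\downarrow^m_k$. - $\vdash\Gamma_1\ \mathtt{ctx}$, $\Gamma_1\ge n\ge k$, $\vdash\Gamma_2,x{:}A_m\ \mathtt{ctx}$, $\Gamma_1\vdash A_m\downarrow^m_n:\mathtt{Type}_n$, $\Gamma_1\vdash e:A_m\downarrow^m_n$, $\Gamma_2,x{:}A_m\vdash f:B_k$ $\Rightarrow\Gamma_1\bowtie\Gamma_2\vdash\mathsf{load}(x)=e\ \mathsf{in}\ f:B_k$. - $\Gamma,\alpha{:}K_m\vdash e:A_k\Rightarrow\Gamma\vdash\Lambda(\alpha{:}K_m).e:(\alpha{:}K_m)\to A_k$; $\ \Gamma,x{:}A_k\vdash e:B_k\Rightarrow\Gamma\vdash\lambda(x{:}A_k).e:A_k\multimap B_k$. - $\vdash\Gamma_1\ \mathtt{ctx}$, $\Gamma_1\ge m\ge k$, $\Gamma_1\bowtie\Gamma_2\vdash(\alpha{:}K_m)\to B_k:\mathtt{Type}_k$, $\Gamma_1\bowtie\Gamma_2\vdash e:(\alpha{:}K_m)\to B_k$, $\Gamma_1\vdash K_m\ \mathtt{kind}$, $\Gamma_1\vdash A_m:K_m$ $\Rightarrow\Gamma_1\bowtie\Gamma_2\vdash e\,A_m:[\alpha{\mapsto}A_m]^{\alpha:K_m^-}B_k$. - $\vdash\Gamma_1\ \mathtt{ctx}$, $\vdash\Gamma_2\ \mathtt{ctx}$, $\Gamma_1\vdash A_k\multimap B_k:\mathtt{Type}_k$,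 $\Gamma_1\vdash e:A_k\multimap B_k$, $\Gamma_2\vdash A_k:\mathtt{Type}_k$, $\Gamma_2\vdash f:A_k$ $\Rightarrow\Gamma_1\bowtie\Gamma_2\vdash e\,f:B_k$. **Typing of substitutions.** - $\Rightarrow\Gamma_W\vdash\cdot:\cdot$. - $\Gamma_1\ge k$, $\Gamma_1\bowtie\Gamma_2\vdash\sigma:\Psi$, $\vdash\Gamma_1\ \mathtt{ctx}$, $\Gamma_1\vdash[\sigma]^{\Psi^-}K_k\ \mathtt{kind}$, $\Gamma_1\vdash A_k:[\sigma]^{\Psi^-}K_k$ $\Rightarrow\Gamma_1\bowtie\Gamma_2\vdash(\sigma,\alpha{\mapsto}A_k):(\Psi,\alpha{:}K_k)$. - $\Gamma_1\ge k$, $\vdash\Gamma_2\ \mathtt{ctx}$, $\Gamma_2\vdash\sigma:\Psi$, $\vdash\Gamma_1\ \mathtt{ctx}$, $\Gamma_1\vdash[\sigma]^{\Psi^-}A_k:\mathtt{Type}_k$, $\Gamma_1\vdash e:[\sigma]^{\Psi^-}A_k$ $\Rightarrow\Gamma_1\bowtie\Gamma_2\vdash(\sigma,x{\mapsto_k}e):(\Psi,x{:}A_k)$. **Elaborated terms.** For the operational semantics terms carry the modes found by type checking: $\ulcorner\hat\Psi.e\urcorner^k_l$ (of a type $[\Psi\vdash A_l]\uparrow^k_l$), $\llcorner e\lrcorner^m_k@\sigma$ ($e$ of a type $[\Psi\vdash A_k]\uparrow^m_k$), $\mathsf{store}^m_k(e)$ (of a type $A_m\downarrow^m_k$), $\mathsf{load}^m_n(x)=e\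 \mathsf{in}\ f$ ($e$ of a type $A_m\downarrow^m_n$). Substitutions are likewise elaborated, and $[\sigma]e$ abbreviates $[\sigma]^{\delta}e$ with $\delta$ the erasure of the domain context of $\sigma$ found by type checking ($\Psi^-$ for the $\sigma$ of $\llcorner e\lrcorner@\sigma$; $\alpha{:}K^-$, resp. $x$, for a single substitution). **Results.** Weak normal forms $v,u::=\ulcorner\hat\Psi.a^k\urcorner^k_l\mid\mathsf{store}^k_l(v)\mid\Lambda(\alpha{:}K_k).e\mid\lambda(x{:}A_k).e\mid\mathsf{one}\mid q$. Weak neutral forms $q::=x\mid\llcorner q\lrcorner^m_k@\sigma\mid\mathsf{load}^m_k(x)=q\ \mathsf{in}\ e\mid q\,A_k\mid q\,v$. Normal templates in mode $k$: $a^k,b^k::=x\mid\mathsf{one}\mid\ulcorner\hat\Psi.a^k\urcorner^{l_0}_{l_1}\mid\llcorner a^k\lrcorner^{l_0}_{l_1}@\sigma$ (if $l_0\not\ge k$) $\mid\llcorner q\lrcorner^{m}_{l_1}@\sigma$ (if $m\ge k$) $\mid\mathsf{store}^{l_0}_{l_1}(a^k)$ (if $l_0\not\ge k$) $\mid\mathsf{store}^m_{l_1}(v)$ (if $m\ge k$) $\mid\mathsf{load}^{l_0}_{l_1}(x)=a^k\ \mathsf{in}\ b^k$ (if $l_1\not\ge k$) $\mid\mathsf{load}^{l_0}_{l_1}(x)=v\ \mathsf{in}\ b^k$ (if $l_1\ge k$) $\mid\Lambda(\alpha{:}K_l).a^k\mid a^k\,A_l\mid\lambda(x{:}A_l).a^k\mid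 a^k\,b^k$. **Evaluation $e\longrightarrow e'$.** Reductions: $\llcorner\ulcorner\hat\Psi.a^m\urcorner^m_k\lrcorner^m_k@\sigma\longrightarrow[\sigma]a^m$; $\ \mathsf{load}^m_n(x)=\mathsf{store}^m_n(v)\ \mathsf{in}\ e_2\longrightarrow[x{\mapsto_m}v]e_2$; $\ (\Lambda(\alpha{:}K_k).e)\,A_k\longrightarrow[\alpha{\mapsto}A_k]e$; $\ (\lambda(x{:}A_k).e)\,u\longrightarrow[x{\mapsto_k}u]e$. Congruences: if $e\rightsquigarrow^k e'$ then $\ulcorner\hat\Psi.e\urcorner^k_l\longrightarrow\ulcorner\hat\Psi.e'\urcorner^k_l$; if $e\longrightarrow e'$ then $\llcorner e\lrcorner^m_k@\sigma\longrightarrow\llcorner e'\lrcorner^m_k@\sigma$, $\mathsf{store}^m_k(e)\longrightarrow\mathsf{store}^m_k(e')$, $\mathsf{load}^m_n(x)=e\ \mathsf{in}\ e_2\longrightarrow\mathsf{load}^m_n(x)=e'\ \mathsf{in}\ e_2$, $e\,A_k\longrightarrow e'\,A_k$, $e\,f\longrightarrow e'\,f$; if $f\longrightarrow f'$ then $v\,f\longrightarrow v\,f'$. **Template reduction $e\rightsquigarrow^m e'$.** - If $n\ge m$: $\llcorner\ulcorner\hat\Psi.a^n\urcorner^n_k\lrcorner^n_k@\sigma\rightsquigarrow^m[\sigma]a^n$. - If $e\rightsquigarrow^m e'$: $\ulcorner\hat\Psi.e\urcorner^k_l\rightsquigarrow^m\ulcorner\hat\Psi.e'\urcorner^k_l$;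 $\Lambda(\alpha{:}K_k).e\rightsquigarrow^m\Lambda(\alpha{:}K_k).e'$; $e\,A_k\rightsquigarrow^m e'\,A_k$; $\lambda(x{:}A_k).e\rightsquigarrow^m\lambda(x{:}A_k).e'$; $e\,f\rightsquigarrow^m e'\,f$. If $f\rightsquigarrow^m f'$: $a^m\,f\rightsquigarrow^m a^m\,f'$. - $\llcorner e\lrcorner^n_k@\sigma\rightsquigarrow^m\llcorner e'\lrcorner^n_k@\sigma$ and $\mathsf{store}^n_k(e)\rightsquigarrow^m\mathsf{store}^n_k(e')$, each if either ($n\not\ge m$ and $e\rightsquigarrow^m e'$) or ($n\ge m$ and $e\longrightarrow e'$). - $\mathsf{load}^n_l(x)=e\ \mathsf{in}\ f\rightsquigarrow^m\mathsf{load}^n_l(x)=e'\ \mathsf{in}\ f$ if either ($l\not\ge m$ and $e\rightsquigarrow^m e'$) or ($l\ge m$ and $e\longrightarrow e'$). - If $f\rightsquigarrow^m f'$: $\mathsf{load}^n_l(x)=a^m\ \mathsf{in}\ f\rightsquigarrow^m\mathsf{load}^n_l(x)=a^m\ \mathsf{in}\ f'$ when $l\not\ge m$; $\mathsf{load}^n_l(x)=v\ \mathsf{in}\ f\rightsquigarrow^m\mathsf{load}^n_l(x)=v\ \mathsf{in}\ f'$ when $l\ge m$.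
   Formalization: Hereditary substitution on ⌞P⌟@τ is also defined, as ⌞P'⌟@τ', when substituting in P returns a neutral type with a kind, P':κ (e.g. α↦β); with the clauses read literally it fails there, and a well-typed (Λα.e)β whose body contains ⌞α⌟@· is stuck. *)

(* Defs.v *)
From Stdlib Require Import List Arith Relations Ensembles.
Import ListNotations.

Inductive structural : Set := Contraction | Weakening.

Record mode_spec := {
  mode :> Type;
  mode_ge : relation mode;
  mode_ge_preorder : preorder mode mode_ge;
  mode_struct : mode -> Ensemble structural;
  mode_struct_mono : forall m k : mode,
    mode_ge m k -> Included structural (mode_struct k) (mode_struct m)
}.

Arguments mode_ge {_}.
Arguments mode_struct {_}.

Definition mode_gt {M : mode_spec} (k j : M) : Prop :=
  mode_ge k j /\ ~ mode_ge j k.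

(* Terms are considered up to renaming of bound variables, so variables are de
   Bruijn indices.  Type variables and term variables share one index space:
   index [i] designates the i-th declaration of the context, counted from the
   right.  The list of names [Psi^] bound by a quotation thus becomes the list
   of the sorts of the declared variables, last declaration first. *)
Inductive vsort : Set := TypeVar | TermVar.

Section Calculus.

Context {M : mode_spec}.
Implicit Types (m n k l : M) (i j d : nat).

(** * Syntax *)

(* Dependency-free kinds and contexts. *)
Inductive skind : Type :=
| SKType (k : M)
| SKUp (k l : M) (psi : sctx) (kappa : skind)
with sctx : Type :=
| XNil
| XTy (gamma : sctx) (kappa : skind)
| XTm (gamma : sctx).

(* [KUp k l Psi K] is [Psi |- K]^k_l (up-shift), [TUp k l Psi A] likewise,
   [TDown n k A] is the down-shift of [A] from mode [n] to mode [k].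

   Terms are the elaborated ones: they carry the modes of the types of their
   subterms, and [Splice m k delta e sigma] in addition carries the erasure
   [delta] of the domain context of [sigma].  The substitutions occurring in
   types are elaborated in the same way.

   In [ctx] and [sub] the last declaration is outermost in the syntax tree and
   has index 0; the entries of a substitution are matched by position with the
   declarations of its domain. *)
Inductive kind : Type :=
| KType (k : M)
| KUp (k l : M) (Psi : ctx) (K : kind)
with ty : Type :=
| TNeu (P : neu)
| TOne (k : M)
| TQuote (h : list vsort) (A : ty)
| TUp (k l : M) (Psi : ctx) (A : ty)
| TDown (n k : M) (A : ty)
| TForall (m : M) (K : kind) (A : ty)
| TLolli (A B : ty)
with neu : Type :=
| NVar (i : nat)
| NSplice (P : neu) (sigma : sub)
with tm : Type :=
| Var (i : nat)
| One
| Quote (k l : M) (h : list vsort) (e : tm)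
| Splice (m k : M) (delta : sctx) (e : tm) (sigma : sub)
| Store (m k : M) (e : tm)
| LetLoad (m n : M) (e f : tm)
| TLam (k : M) (K : kind) (e : tm)
| TApp (e : tm) (k : M) (A : ty)
| Lam (k : M) (A : ty) (e : tm)
| App (e f : tm)
with ctx : Type :=
| CNil
| CTy (Psi : ctx) (k : M) (K : kind)
| CTm (Psi : ctx) (k : M) (A : ty)
with sub : Type :=
| SNil
| STy (sigma : sub) (k : M) (A : ty)
| STm (sigma : sub) (k : M) (e : tm).

Fixpoint hat (Psi : ctx) : list vsort :=
  match Psi with
  | CNil => []
  | CTy Psi _ _ => TypeVar :: hat Psi
  | CTm Psi _ _ => TermVar :: hat Psi
  end.

Fixpoint shat (psi : sctx) : list vsort :=
  match psi with
  | XNil => []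
  | XTy psi _ => TypeVar :: shat psi
  | XTm psi => TermVar :: shat psi
  end.

Fixpoint erase_kind (K : kind) : skind :=
  match K with
  | KType k => SKType k
  | KUp k l Psi K => SKUp k l (erase_ctx Psi) (erase_kind K)
  end
with erase_ctx (Psi : ctx) : sctx :=
  match Psi with
  | CNil => XNil
  | CTy Psi _ K => XTy (erase_ctx Psi) (erase_kind K)
  | CTm Psi _ _ => XTm (erase_ctx Psi)
  end.

Definition ctx_len (Psi : ctx) : nat := length (hat Psi).

(* Weakening: adds [d] to all indices that are at least the cutoff [c]. *)
Fixpoint lift_kind (c d : nat) (K : kind) : kind :=
  match K with
  | KType k => KType k
  | KUp k l Psi K => KUp k l (lift_ctx c d Psi) (lift_kind (ctx_len Psi + c) d K)
  end
with lift_ty (c d : nat) (A : ty) : ty :=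
  match A with
  | TNeu P => TNeu (lift_neu c d P)
  | TOne k => TOne k
  | TQuote h A => TQuote h (lift_ty (length h + c) d A)
  | TUp k l Psi A => TUp k l (lift_ctx c d Psi) (lift_ty (ctx_len Psi + c) d A)
  | TDown n k A => TDown n k (lift_ty c d A)
  | TForall m K A => TForall m (lift_kind c d K) (lift_ty (S c) d A)
  | TLolli A B => TLolli (lift_ty c d A) (lift_ty c d B)
  end
with lift_neu (c d : nat) (P : neu) : neu :=
  match P with
  | NVar i => NVar (if c <=? i then d + i else i)
  | NSplice P sigma => NSplice (lift_neu c d P) (lift_sub c d sigma)
  end
with lift_tm (c d : nat) (e : tm) : tm :=
  match e with
  | Var i => Var (if c <=? i then d + i else i)
  | One => One
  | Quote k l h e => Quote k l h (lift_tm (length h + c) d e)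
  | Splice m k delta e sigma =>
      Splice m k delta (lift_tm c d e) (lift_sub c d sigma)
  | Store m k e => Store m k (lift_tm c d e)
  | LetLoad m n e f => LetLoad m n (lift_tm c d e) (lift_tm (S c) d f)
  | TLam k K e => TLam k (lift_kind c d K) (lift_tm (S c) d e)
  | TApp e k A => TApp (lift_tm c d e) k (lift_ty c d A)
  | Lam k A e => Lam k (lift_ty c d A) (lift_tm (S c) d e)
  | App e f => App (lift_tm c d e) (lift_tm c d f)
  end
with lift_ctx (c d : nat) (Psi : ctx) : ctx :=
  match Psi with
  | CNil => CNil
  | CTy Psi k K => CTy (lift_ctx c d Psi) k (lift_kind (ctx_len Psi + c) d K)
  | CTm Psi k A => CTm (lift_ctx c d Psi) k (lift_ty (ctx_len Psi + c) d A)
  end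
with lift_sub (c d : nat) (sigma : sub) : sub :=
  match sigma with
  | SNil => SNil
  | STy sigma k A => STy (lift_sub c d sigma) k (lift_ty c d A)
  | STm sigma k e => STm (lift_sub c d sigma) k (lift_tm c d e)
  end.

(** * Hereditary substitution *)

Fixpoint sub_len (sigma : sub) : nat :=
  match sigma with
  | SNil => 0
  | STy sigma _ _ | STm sigma _ _ => S (sub_len sigma)
  end.

Fixpoint sub_ty_at (sigma : sub) (i : nat) : option ty :=
  match sigma, i with
  | STy _ _ A, 0 => Some A
  | STy sigma _ _, S i | STm sigma _ _, S i => sub_ty_at sigma i
  | _, _ => None
  end.

Fixpoint sub_tm_at (sigma : sub) (i : nat) : option tm :=
  match sigma, i with
  | STm _ _ e, 0 => Some e
  | STy sigma _ _, S i | STm sigma _ _, S i => sub_tm_at sigma i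
  | _, _ => None
  end.

Fixpoint sctx_kind_at (gamma : sctx) (i : nat) : option skind :=
  match gamma, i with
  | XTy _ kappa, 0 => Some kappa
  | XTy gamma _, S i | XTm gamma, S i => sctx_kind_at gamma i
  | _, _ => None
  end.

Inductive neu_result : Type :=
| RTy (A : ty) (kappa : skind)
| RNeu (Q : neu).

(* The partial operation [sigma]^gamma is given by its graph; it fails where no
   result is derivable.  The argument [d] is the number of binders crossed:
   indices below [d] are bound locally, the next [sub_len sigma] ones are the
   domain of [sigma], and the remaining ones are left fixed (and renumbered,
   since the domain of [sigma] disappears). *)
Inductive hs_kind : sctx -> sub -> nat -> kind -> kind -> Prop :=
| hs_KType gamma sigma d k :
    hs_kind gamma sigma d (KType k) (KType k)
| hs_KUp gamma sigma d k l Psi Psi' K K' :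
    hs_ctx gamma sigma d Psi Psi' ->
    hs_kind gamma sigma (ctx_len Psi + d) K K' ->
    hs_kind gamma sigma d (KUp k l Psi K) (KUp k l Psi' K')

with hs_ty : sctx -> sub -> nat -> ty -> ty -> Prop :=
| hs_TNeu_ty gamma sigma d P A kappa :
    hs_neu gamma sigma d P (RTy A kappa) ->
    hs_ty gamma sigma d (TNeu P) A
| hs_TNeu_neu gamma sigma d P Q :
    hs_neu gamma sigma d P (RNeu Q) ->
    hs_ty gamma sigma d (TNeu P) (TNeu Q)
| hs_TOne gamma sigma d k :
    hs_ty gamma sigma d (TOne k) (TOne k)
| hs_TQuote gamma sigma d h A A' :
    hs_ty gamma sigma (length h + d) A A' ->
    hs_ty gamma sigma d (TQuote h A) (TQuote h A')
| hs_TUp gamma sigma d k l Psi Psi' A A' :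
    hs_ctx gamma sigma d Psi Psi' ->
    hs_ty gamma sigma (ctx_len Psi + d) A A' ->
    hs_ty gamma sigma d (TUp k l Psi A) (TUp k l Psi' A')
| hs_TDown gamma sigma d n k A A' :
    hs_ty gamma sigma d A A' ->
    hs_ty gamma sigma d (TDown n k A) (TDown n k A')
| hs_TForall gamma sigma d m K K' A A' :
    hs_kind gamma sigma d K K' ->
    hs_ty gamma sigma (S d) A A' ->
    hs_ty gamma sigma d (TForall m K A) (TForall m K' A')
| hs_TLolli gamma sigma d A A' B B' :
    hs_ty gamma sigma d A A' ->
    hs_ty gamma sigma d B B' ->
    hs_ty gamma sigma d (TLolli A B) (TLolli A' B')

with hs_neu : sctx -> sub -> nat -> neu -> neu_result -> Prop :=
| hs_NVar_bound gamma sigma d i :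
    i < d ->
    hs_neu gamma sigma d (NVar i) (RNeu (NVar i))
| hs_NVar_dom gamma sigma d j A kappa :
    sub_ty_at sigma j = Some A ->
    sctx_kind_at gamma j = Some kappa ->
    hs_neu gamma sigma d (NVar (d + j)) (RTy (lift_ty 0 d A) kappa)
| hs_NVar_free gamma sigma d j :
    hs_neu gamma sigma d (NVar (d + sub_len sigma + j)) (RNeu (NVar (d + j)))
| hs_NSplice_quote gamma sigma d P tau tau' m k psi kappa A A' :
    hs_neu gamma sigma d P (RTy (TQuote (shat psi) A) (SKUp m k psi kappa)) ->
    hs_sub gamma sigma d tau tau' ->
    hs_ty psi tau' 0 A A' ->
    hs_neu gamma sigma d (NSplice P tau) (RTy A' kappa)
(* The result [P'] for [P] may be neutral for two reasons: the head of [P] is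
   not in the domain of [sigma], or [sigma] maps it to a neutral type (types
   are not required to be eta-long). *)
| hs_NSplice_neu gamma sigma d P P' tau tau' :
    hs_neu gamma sigma d P (RNeu P') ->
    hs_sub gamma sigma d tau tau' ->
    hs_neu gamma sigma d (NSplice P tau) (RNeu (NSplice P' tau'))
| hs_NSplice_tyneu gamma sigma d P P' kappa tau tau' :
    hs_neu gamma sigma d P (RTy (TNeu P') kappa) ->
    hs_sub gamma sigma d tau tau' ->
    hs_neu gamma sigma d (NSplice P tau) (RNeu (NSplice P' tau'))

with hs_tm : sctx -> sub -> nat -> tm -> tm -> Prop :=
| hs_Var_bound gamma sigma d i :
    i < d ->
    hs_tm gamma sigma d (Var i) (Var i)
| hs_Var_dom gamma sigma d j e :
    sub_tm_at sigma j = Some e ->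
    hs_tm gamma sigma d (Var (d + j)) (lift_tm 0 d e)
| hs_Var_free gamma sigma d j :
    hs_tm gamma sigma d (Var (d + sub_len sigma + j)) (Var (d + j))
| hs_One gamma sigma d :
    hs_tm gamma sigma d One One
| hs_Quote gamma sigma d k l h e e' :
    hs_tm gamma sigma (length h + d) e e' ->
    hs_tm gamma sigma d (Quote k l h e) (Quote k l h e')
| hs_Splice gamma sigma d m k delta e e' tau tau' :
    hs_tm gamma sigma d e e' ->
    hs_sub gamma sigma d tau tau' ->
    hs_tm gamma sigma d (Splice m k delta e tau) (Splice m k delta e' tau')
| hs_Store gamma sigma d m k e e' :
    hs_tm gamma sigma d e e' ->
    hs_tm gamma sigma d (Store m k e) (Store m k e')
| hs_Load gamma sigma d m n e e' f f' :
    hs_tm gamma sigma d e e' ->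
    hs_tm gamma sigma (S d) f f' ->
    hs_tm gamma sigma d (LetLoad m n e f) (LetLoad m n e' f')
| hs_TLam gamma sigma d k K K' e e' :
    hs_kind gamma sigma d K K' ->
    hs_tm gamma sigma (S d) e e' ->
    hs_tm gamma sigma d (TLam k K e) (TLam k K' e')
| hs_TApp gamma sigma d e e' k A A' :
    hs_tm gamma sigma d e e' ->
    hs_ty gamma sigma d A A' ->
    hs_tm gamma sigma d (TApp e k A) (TApp e' k A')
| hs_Lam gamma sigma d k A A' e e' :
    hs_ty gamma sigma d A A' ->
    hs_tm gamma sigma (S d) e e' ->
    hs_tm gamma sigma d (Lam k A e) (Lam k A' e')
| hs_App gamma sigma d e e' f f' :
    hs_tm gamma sigma d e e' ->
    hs_tm gamma sigma d f f' ->
    hs_tm gamma sigma d (App e f) (App e' f')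

with hs_ctx : sctx -> sub -> nat -> ctx -> ctx -> Prop :=
| hs_CNil gamma sigma d :
    hs_ctx gamma sigma d CNil CNil
| hs_CTy gamma sigma d Psi Psi' k K K' :
    hs_ctx gamma sigma d Psi Psi' ->
    hs_kind gamma sigma (ctx_len Psi + d) K K' ->
    hs_ctx gamma sigma d (CTy Psi k K) (CTy Psi' k K')
| hs_CTm gamma sigma d Psi Psi' k A A' :
    hs_ctx gamma sigma d Psi Psi' ->
    hs_ty gamma sigma (ctx_len Psi + d) A A' ->
    hs_ctx gamma sigma d (CTm Psi k A) (CTm Psi' k A')

with hs_sub : sctx -> sub -> nat -> sub -> sub -> Prop :=
| hs_SNil gamma sigma d :
    hs_sub gamma sigma d SNil SNil
| hs_STy gamma sigma d tau tau' k A A' :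
    hs_sub gamma sigma d tau tau' ->
    hs_ty gamma sigma d A A' ->
    hs_sub gamma sigma d (STy tau k A) (STy tau' k A')
| hs_STm gamma sigma d tau tau' k e e' :
    hs_sub gamma sigma d tau tau' ->
    hs_tm gamma sigma d e e' ->
    hs_sub gamma sigma d (STm tau k e) (STm tau' k e').

(** * Typing contexts *)

(* Context splitting sends a declaration to only one side, which would renumber
   the variables of the other side.  The contexts of judgements therefore may
   contain holes: [None] marks an index at which nothing is declared.  A context
   with holes stands for the context of its actual declarations. *)
Inductive decl : Type :=
| DTy (k : M) (K : kind)
| DTm (k : M) (A : ty).

Definition env : Type := list (option decl).

Definition decl_mode (D : decl) : M :=
  match D with DTy k _ => k | DTm k _ => k end.

(* [Gamma, Psi] *)
Fixpoint env_app (Gamma : env) (Psi : ctx) : env :=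
  match Psi with
  | CNil => Gamma
  | CTy Psi k K => Some (DTy k K) :: env_app Gamma Psi
  | CTm Psi k A => Some (DTm k A) :: env_app Gamma Psi
  end.

Definition declares (Gamma : env) (i : nat) (D : decl) : Prop :=
  nth_error Gamma i = Some (Some D).

Definition env_ge (Gamma : env) (k : M) : Prop :=
  forall i D, declares Gamma i D -> mode_ge (decl_mode D) k.

(* [k > Psi >= l], including [k >= l]. *)
Definition ctx_between (k : M) (Psi : ctx) (l : M) : Prop :=
  mode_ge k l /\
  forall i D, declares (env_app [] Psi) i D ->
    mode_gt k (decl_mode D) /\ mode_ge (decl_mode D) l.

(* [split Gamma1 Gamma2 Gamma] is [Gamma1 |><| Gamma2 = Gamma]. *)
Inductive split : env -> env -> env -> Prop :=
| split_nil : split [] [] []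
| split_hole Gamma1 Gamma2 Gamma :
    split Gamma1 Gamma2 Gamma ->
    split (None :: Gamma1) (None :: Gamma2) (None :: Gamma)
| split_ty_both Gamma1 Gamma2 Gamma k K :
    split Gamma1 Gamma2 Gamma ->
    split (Some (DTy k K) :: Gamma1) (Some (DTy k K) :: Gamma2)
      (Some (DTy k K) :: Gamma)
| split_ty_l Gamma1 Gamma2 Gamma k K :
    split Gamma1 Gamma2 Gamma ->
    split (Some (DTy k K) :: Gamma1) (None :: Gamma2) (Some (DTy k K) :: Gamma)
| split_ty_r Gamma1 Gamma2 Gamma k K :
    split Gamma1 Gamma2 Gamma ->
    split (None :: Gamma1) (Some (DTy k K) :: Gamma2) (Some (DTy k K) :: Gamma)
| split_tm_both Gamma1 Gamma2 Gamma k A :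
    split Gamma1 Gamma2 Gamma ->
    In structural (mode_struct k) Contraction ->
    split (Some (DTm k A) :: Gamma1) (Some (DTm k A) :: Gamma2)
      (Some (DTm k A) :: Gamma)
| split_tm_l Gamma1 Gamma2 Gamma k A :
    split Gamma1 Gamma2 Gamma ->
    split (Some (DTm k A) :: Gamma1) (None :: Gamma2) (Some (DTm k A) :: Gamma)
| split_tm_r Gamma1 Gamma2 Gamma k A :
    split Gamma1 Gamma2 Gamma ->
    split (None :: Gamma1) (Some (DTm k A) :: Gamma2) (Some (DTm k A) :: Gamma).

(* [Gamma] is a context [Gamma_W]. *)
Definition weakenable (Gamma : env) : Prop :=
  forall i k A, declares Gamma i (DTm k A) ->
    In structural (mode_struct k) Weakening.

(* [Gamma] is the one-declaration context consisting of [D] at index [i]. *)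
Definition singleton_env (Gamma : env) (i : nat) (D : decl) : Prop :=
  declares Gamma i D /\ forall j D', declares Gamma j D' -> j = i.

(** * Well-formedness and typing *)

(* [wf_kind Gamma k K] is [Gamma |- K_k kind], [has_kind Gamma k A K] is
   [Gamma |- A_k : K_k], [has_type Gamma k e A] is [Gamma |- e : A_k].

   The rules have exactly the explicit premises of the calculus.  The
   presuppositions of a judgement are not part of its derivability: they are
   conditions under which the judgement is considered, and are to be assumed
   where the judgement is used. *)
Inductive wf_kind : env -> M -> kind -> Prop :=
| wf_KType Gamma k :
    wf_kind Gamma k (KType k)
| wf_KUp Gamma k l Psi K :
    ctx_between k Psi l ->
    wf_ctx (env_app Gamma Psi) ->
    wf_kind (env_app Gamma Psi) l K ->
    wf_kind Gamma k (KUp k l Psi K)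

with has_kind : env -> M -> ty -> kind -> Prop :=
| hk_Var Gamma i k K :
    declares Gamma i (DTy k K) ->
    has_kind Gamma k (TNeu (NVar i)) (lift_kind 0 (S i) K)
| hk_Quote Gamma k l Psi A K :
    has_kind (env_app Gamma Psi) l A K ->
    has_kind Gamma k (TQuote (hat Psi) A) (KUp k l Psi K)
| hk_Splice Gamma1 Gamma2 Gamma m k Psi K K' P sigma :
    split Gamma1 Gamma2 Gamma ->
    env_ge Gamma1 m ->
    wf_ctx Gamma1 ->
    wf_ctx (env_app Gamma Psi) ->
    wf_kind Gamma1 m (KUp m k Psi K) ->
    has_kind Gamma1 m (TNeu P) (KUp m k Psi K) ->
    has_sub Gamma sigma Psi ->
    hs_kind (erase_ctx Psi) sigma 0 K K' ->
    has_kind Gamma k (TNeu (NSplice P sigma)) K'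
| hk_Up Gamma k l Psi A :
    ctx_between k Psi l ->
    wf_ctx (env_app Gamma Psi) ->
    has_kind (env_app Gamma Psi) l A (KType l) ->
    has_kind Gamma k (TUp k l Psi A) (KType k)
| hk_Down Gamma1 Gamma2 Gamma m k A :
    split Gamma1 Gamma2 Gamma ->
    env_ge Gamma1 m ->
    mode_ge m k ->
    wf_ctx Gamma1 ->
    has_kind Gamma1 m A (KType m) ->
    has_kind Gamma k (TDown m k A) (KType k)
| hk_Forall Gamma1 Gamma2 Gamma m k K A :
    split Gamma1 Gamma2 Gamma ->
    env_ge Gamma1 m ->
    mode_ge m k ->
    wf_ctx Gamma1 ->
    wf_kind Gamma1 m K ->
    has_kind (Some (DTy m K) :: Gamma) k A (KType k) ->
    has_kind Gamma k (TForall m K A) (KType k)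
| hk_Lolli Gamma k A B :
    has_kind Gamma k A (KType k) ->
    has_kind Gamma k B (KType k) ->
    has_kind Gamma k (TLolli A B) (KType k)
| hk_One Gamma k :
    has_kind Gamma k (TOne k) (KType k)

with wf_ctx : env -> Prop :=
| wf_nil :
    wf_ctx []
| wf_hole Gamma :
    wf_ctx Gamma ->
    wf_ctx (None :: Gamma)
| wf_ty Gamma1 Gamma2 Gamma k K :
    split Gamma1 Gamma2 Gamma ->
    env_ge Gamma1 k ->
    wf_ctx Gamma1 ->
    wf_ctx Gamma ->
    wf_kind Gamma1 k K ->
    wf_ctx (Some (DTy k K) :: Gamma)
| wf_tm Gamma1 Gamma2 Gamma k A :
    split Gamma1 Gamma2 Gamma ->
    env_ge Gamma1 k ->
    wf_ctx Gamma1 ->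
    wf_ctx Gamma ->
    has_kind Gamma1 k A (KType k) ->
    wf_ctx (Some (DTm k A) :: Gamma)

with has_type : env -> M -> tm -> ty -> Prop :=
| ht_Var Gamma1 GammaW Gamma i k A :
    singleton_env Gamma1 i (DTm k A) ->
    weakenable GammaW ->
    split Gamma1 GammaW Gamma ->
    has_type Gamma k (Var i) (lift_ty 0 (S i) A)
| ht_One GammaW k :
    weakenable GammaW ->
    has_type GammaW k One (TOne k)
| ht_Quote Gamma k l Psi e A :
    has_type (env_app Gamma Psi) l e A ->
    has_type Gamma k (Quote k l (hat Psi) e) (TUp k l Psi A)
| ht_Splice Gamma1 Gamma2 Gamma m k Psi e sigma A A' :
    split Gamma1 Gamma2 Gamma ->
    wf_ctx Gamma1 ->
    env_ge Gamma1 m ->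
    wf_ctx (env_app Gamma2 Psi) ->
    has_kind Gamma1 m (TUp m k Psi A) (KType m) ->
    has_type Gamma1 m e (TUp m k Psi A) ->
    has_sub Gamma2 sigma Psi ->
    hs_ty (erase_ctx Psi) sigma 0 A A' ->
    has_type Gamma k (Splice m k (erase_ctx Psi) e sigma) A'
| ht_Store Gamma1 GammaW Gamma m k e A :
    split Gamma1 GammaW Gamma ->
    weakenable GammaW ->
    env_ge Gamma1 m ->
    wf_ctx Gamma1 ->
    has_type Gamma1 m e A ->
    has_type Gamma k (Store m k e) (TDown m k A)
| ht_Load Gamma1 Gamma2 Gamma m n k e f A B :
    split Gamma1 Gamma2 Gamma ->
    wf_ctx Gamma1 ->
    env_ge Gamma1 n ->
    mode_ge n k ->
    wf_ctx (Some (DTm m A) :: Gamma2) ->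
    has_kind Gamma1 n (TDown m n A) (KType n) ->
    has_type Gamma1 n e (TDown m n A) ->
    has_type (Some (DTm m A) :: Gamma2) k f (lift_ty 0 1 B) ->
    has_type Gamma k (LetLoad m n e f) B
| ht_TLam Gamma m k K e A :
    has_type (Some (DTy m K) :: Gamma) k e A ->
    has_type Gamma k (TLam m K e) (TForall m K A)
| ht_Lam Gamma k A e B :
    has_type (Some (DTm k A) :: Gamma) k e (lift_ty 0 1 B) ->
    has_type Gamma k (Lam k A e) (TLolli A B)
| ht_TApp Gamma1 Gamma2 Gamma m k K e A B B' :
    split Gamma1 Gamma2 Gamma ->
    wf_ctx Gamma1 ->
    env_ge Gamma1 m ->
    mode_ge m k ->
    has_kind Gamma k (TForall m K B) (KType k) ->
    has_type Gamma k e (TForall m K B) ->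
    wf_kind Gamma1 m K ->
    has_kind Gamma1 m A K ->
    hs_ty (XTy XNil (erase_kind K)) (STy SNil m A) 0 B B' ->
    has_type Gamma k (TApp e m A) B'
| ht_App Gamma1 Gamma2 Gamma k e f A B :
    split Gamma1 Gamma2 Gamma ->
    wf_ctx Gamma1 ->
    wf_ctx Gamma2 ->
    has_kind Gamma1 k (TLolli A B) (KType k) ->
    has_type Gamma1 k e (TLolli A B) ->
    has_kind Gamma2 k A (KType k) ->
    has_type Gamma2 k f A ->
    has_type Gamma k (App e f) B

with has_sub : env -> sub -> ctx -> Prop :=
| hsub_Nil GammaW :
    weakenable GammaW ->
    has_sub GammaW SNil CNil
| hsub_Ty Gamma1 Gamma2 Gamma sigma Psi k A K K' :
    split Gamma1 Gamma2 Gamma ->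
    env_ge Gamma1 k ->
    has_sub Gamma sigma Psi ->
    wf_ctx Gamma1 ->
    hs_kind (erase_ctx Psi) sigma 0 K K' ->
    wf_kind Gamma1 k K' ->
    has_kind Gamma1 k A K' ->
    has_sub Gamma (STy sigma k A) (CTy Psi k K)
| hsub_Tm Gamma1 Gamma2 Gamma sigma Psi k e A A' :
    split Gamma1 Gamma2 Gamma ->
    env_ge Gamma1 k ->
    wf_ctx Gamma2 ->
    has_sub Gamma2 sigma Psi ->
    wf_ctx Gamma1 ->
    hs_ty (erase_ctx Psi) sigma 0 A A' ->
    has_kind Gamma1 k A' (KType k) ->
    has_type Gamma1 k e A' ->
    has_sub Gamma (STm sigma k e) (CTm Psi k A).

(** * Results *)

(* [template k a]: [a] is a normal template in mode [k]. *)
Inductive wnf : tm -> Prop :=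
| wnf_Quote k l h a :
    template k a -> wnf (Quote k l h a)
| wnf_Store k l v :
    wnf v -> wnf (Store k l v)
| wnf_TLam k K e :
    wnf (TLam k K e)
| wnf_Lam k A e :
    wnf (Lam k A e)
| wnf_One :
    wnf One
| wnf_neutral q :
    wneu q -> wnf q

with wneu : tm -> Prop :=
| wneu_Var i :
    wneu (Var i)
| wneu_Splice m k delta q sigma :
    wneu q -> wneu (Splice m k delta q sigma)
| wneu_Load m k q e :
    wneu q -> wneu (LetLoad m k q e)
| wneu_TApp q k A :
    wneu q -> wneu (TApp q k A)
| wneu_App q v :
    wneu q -> wnf v -> wneu (App q v)

with template : M -> tm -> Prop :=
| tpl_Var k i :
    template k (Var i)
| tpl_One k :
    template k One
| tpl_Quote k l0 l1 h a :
    template k a -> template k (Quote l0 l1 h a)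
| tpl_Splice_below k l0 l1 delta a sigma :
    ~ mode_ge l0 k -> template k a -> template k (Splice l0 l1 delta a sigma)
| tpl_Splice_above k m l1 delta q sigma :
    mode_ge m k -> wneu q -> template k (Splice m l1 delta q sigma)
| tpl_Store_below k l0 l1 a :
    ~ mode_ge l0 k -> template k a -> template k (Store l0 l1 a)
| tpl_Store_above k m l1 v :
    mode_ge m k -> wnf v -> template k (Store m l1 v)
| tpl_Load_below k l0 l1 a b :
    ~ mode_ge l1 k -> template k a -> template k b ->
    template k (LetLoad l0 l1 a b)
| tpl_Load_above k l0 l1 v b :
    mode_ge l1 k -> wnf v -> template k b ->
    template k (LetLoad l0 l1 v b)
| tpl_TLam k l K a :
    template k a -> template k (TLam l K a)
| tpl_TApp k a l A :
    template k a -> template k (TApp a l A)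
| tpl_Lam k l A a :
    template k a -> template k (Lam l A a)
| tpl_App k a b :
    template k a -> template k b -> template k (App a b).

(** * Evaluation and template reduction *)

Inductive step : tm -> tm -> Prop :=
| step_splice_quote m k delta a sigma a' :
    template m a ->
    hs_tm delta sigma 0 a a' ->
    step (Splice m k delta (Quote m k (shat delta) a) sigma) a'
| step_load_store m n v e e' :
    wnf v ->
    hs_tm (XTm XNil) (STm SNil m v) 0 e e' ->
    step (LetLoad m n (Store m n v) e) e'
| step_tbeta k K e A e' :
    hs_tm (XTy XNil (erase_kind K)) (STy SNil k A) 0 e e' ->
    step (TApp (TLam k K e) k A) e'
| step_beta k A e u e' :
    wnf u ->
    hs_tm (XTm XNil) (STm SNil k u) 0 e e' ->
    step (App (Lam k A e) u) e'
| step_Quote k l h e e' :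
    tstep k e e' -> step (Quote k l h e) (Quote k l h e')
| step_Splice m k delta e e' sigma :
    step e e' -> step (Splice m k delta e sigma) (Splice m k delta e' sigma)
| step_Store m k e e' :
    step e e' -> step (Store m k e) (Store m k e')
| step_Load m n e e' f :
    step e e' -> step (LetLoad m n e f) (LetLoad m n e' f)
| step_TApp e e' k A :
    step e e' -> step (TApp e k A) (TApp e' k A)
| step_App_l e e' f :
    step e e' -> step (App e f) (App e' f)
| step_App_r v f f' :
    wnf v -> step f f' -> step (App v f) (App v f')

with tstep : M -> tm -> tm -> Prop :=
| tstep_splice_quote m n k delta a sigma a' :
    mode_ge n m ->
    template n a ->
    hs_tm delta sigma 0 a a' ->
    tstep m (Splice n k delta (Quote n k (shat delta) a) sigma) a'
| tstep_Quote m k l h e e' :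
    tstep m e e' -> tstep m (Quote k l h e) (Quote k l h e')
| tstep_TLam m k K e e' :
    tstep m e e' -> tstep m (TLam k K e) (TLam k K e')
| tstep_TApp m e e' k A :
    tstep m e e' -> tstep m (TApp e k A) (TApp e' k A)
| tstep_Lam m k A e e' :
    tstep m e e' -> tstep m (Lam k A e) (Lam k A e')
| tstep_App_l m e e' f :
    tstep m e e' -> tstep m (App e f) (App e' f)
| tstep_App_r m a f f' :
    template m a -> tstep m f f' -> tstep m (App a f) (App a f')
| tstep_Splice_below m n k delta e e' sigma :
    ~ mode_ge n m -> tstep m e e' ->
    tstep m (Splice n k delta e sigma) (Splice n k delta e' sigma)
| tstep_Splice_above m n k delta e e' sigma :
    mode_ge n m -> step e e' ->
    tstep m (Splice n k delta e sigma) (Splice n k delta e' sigma)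
| tstep_Store_below m n k e e' :
    ~ mode_ge n m -> tstep m e e' -> tstep m (Store n k e) (Store n k e')
| tstep_Store_above m n k e e' :
    mode_ge n m -> step e e' -> tstep m (Store n k e) (Store n k e')
| tstep_Load_below m n l e e' f :
    ~ mode_ge l m -> tstep m e e' -> tstep m (LetLoad n l e f) (LetLoad n l e' f)
| tstep_Load_above m n l e e' f :
    mode_ge l m -> step e e' -> tstep m (LetLoad n l e f) (LetLoad n l e' f)
| tstep_Load_body_below m n l a f f' :
    ~ mode_ge l m -> template m a -> tstep m f f' ->
    tstep m (LetLoad n l a f) (LetLoad n l a f')
| tstep_Load_body_above m n l v f f' :
    mode_ge l m -> wnf v -> tstep m f f' ->
    tstep m (LetLoad n l v f) (LetLoad n l v f').

End Calculus.

Arguments skind : clear implicits.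
Arguments sctx : clear implicits.
Arguments kind : clear implicits.
Arguments ty : clear implicits.
Arguments neu : clear implicits.
Arguments tm : clear implicits.
Arguments ctx : clear implicits.
Arguments sub : clear implicits.
Arguments neu_result : clear implicits.
Arguments decl : clear implicits.
Arguments env : clear implicits.

(* Main.v *)
(* The only non-trivial point is that the reducts exist, i.e. that hereditary
   substitution is defined on what a redex contains.  Definedness depends only
   on a simple kinding discipline in which kinds are erased, terms are merely
   well scoped and resources are ignored; every typed term obeys it.  For simply
   kinded objects, [sigma]^gamma is defined by induction on the total size of the
   kinds in gamma, then on the object: a substitution triggered by splicing a
   quotation of kind [psi |- kappa] has a domain psi strictly smaller than gamma,
   since the kind of the quotation is part of a kind in gamma.  The rest is
   canonical forms. *)

From Stdlib Require Import List Arith Lia Classical.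
Require Import Defs.
Import ListNotations.

(** * Simple kinding: erased kinds, well-scoped terms, no resources *)

Section Simple.

Context {M : mode_spec}.

(* [Some kappa] declares a type variable, [None] a term variable. *)
Definition senv : Type := list (option (skind M)).

Fixpoint entries (psi : sctx M) : senv :=
  match psi with
  | XNil => []
  | XTy psi kappa => Some kappa :: entries psi
  | XTm psi => None :: entries psi
  end.

(** Erased kinds are dependency-free, so splicing needs no substitution in the resulting kind. Terms
    carry no type here, but the types and kinds inside them stay kinded because substitution
    traverses them. *)
Inductive simple_kind : senv -> kind M -> Prop :=
| sk_Type E k : simple_kind E (KType k)
| sk_Up E k l Psi K :
    simple_ctx E Psi ->
    simple_kind (entries (erase_ctx Psi) ++ E) K ->
    simple_kind E (KUp k l Psi K)

with simple_ty : senv -> ty M -> skind M -> Prop :=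
| sty_Neu E P kappa :
    simple_neu E P kappa -> simple_ty E (TNeu P) kappa
| sty_One E k : simple_ty E (TOne k) (SKType k)
| sty_Quote E k l psi A kappa :
    simple_ty (entries psi ++ E) A kappa ->
    simple_ty E (TQuote (shat psi) A) (SKUp k l psi kappa)
| sty_Up E k l Psi A :
    simple_ctx E Psi ->
    simple_ty (entries (erase_ctx Psi) ++ E) A (SKType l) ->
    simple_ty E (TUp k l Psi A) (SKType k)
| sty_Down E n k A :
    simple_ty E A (SKType n) -> simple_ty E (TDown n k A) (SKType k)
| sty_Forall E m k K A :
    simple_kind E K ->
    simple_ty (Some (erase_kind K) :: E) A (SKType k) ->
    simple_ty E (TForall m K A) (SKType k)
| sty_Lolli E k A B :
    simple_ty E A (SKType k) -> simple_ty E B (SKType k) ->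
    simple_ty E (TLolli A B) (SKType k)

with simple_neu : senv -> neu M -> skind M -> Prop :=
| sn_Var E i kappa :
    nth_error E i = Some (Some kappa) -> simple_neu E (NVar i) kappa
| sn_Splice E P m k psi kappa sigma :
    simple_neu E P (SKUp m k psi kappa) ->
    simple_sub E sigma psi ->
    simple_neu E (NSplice P sigma) kappa

with simple_tm : senv -> tm M -> Prop :=
| stm_Var E i : nth_error E i = Some None -> simple_tm E (Var i)
| stm_One E : simple_tm E One
| stm_Quote E k l psi e :
    simple_tm (entries psi ++ E) e -> simple_tm E (Quote k l (shat psi) e)
| stm_Splice E m k delta e sigma :
    simple_tm E e -> simple_sub E sigma delta ->
    simple_tm E (Splice m k delta e sigma)
| stm_Store E m k e : simple_tm E e -> simple_tm E (Store m k e)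
| stm_Load E m n e f :
    simple_tm E e -> simple_tm (None :: E) f -> simple_tm E (LetLoad m n e f)
| stm_TLam E k K e :
    simple_kind E K -> simple_tm (Some (erase_kind K) :: E) e ->
    simple_tm E (TLam k K e)
| stm_TApp E e k A kappa :
    simple_tm E e -> simple_ty E A kappa -> simple_tm E (TApp e k A)
| stm_Lam E k A e :
    simple_ty E A (SKType k) -> simple_tm (None :: E) e ->
    simple_tm E (Lam k A e)
| stm_App E e f : simple_tm E e -> simple_tm E f -> simple_tm E (App e f)

with simple_ctx : senv -> ctx M -> Prop :=
| sc_Nil E : simple_ctx E CNil
| sc_Ty E Psi k K :
    simple_ctx E Psi ->
    simple_kind (entries (erase_ctx Psi) ++ E) K ->
    simple_ctx E (CTy Psi k K)
| sc_Tm E Psi k A :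
    simple_ctx E Psi ->
    simple_ty (entries (erase_ctx Psi) ++ E) A (SKType k) ->
    simple_ctx E (CTm Psi k A)

with simple_sub : senv -> sub M -> sctx M -> Prop :=
| ssub_Nil E : simple_sub E SNil XNil
| ssub_Ty E sigma psi k A kappa :
    simple_sub E sigma psi -> simple_ty E A kappa ->
    simple_sub E (STy sigma k A) (XTy psi kappa)
| ssub_Tm E sigma psi k e :
    simple_sub E sigma psi -> simple_tm E e ->
    simple_sub E (STm sigma k e) (XTm psi).

Scheme simple_kind_mind := Minimality for simple_kind Sort Prop
  with simple_ty_mind := Minimality for simple_ty Sort Prop
  with simple_neu_mind := Minimality for simple_neu Sort Prop
  with simple_tm_mind := Minimality for simple_tm Sort Prop
  with simple_ctx_mind := Minimality for simple_ctx Sort Prop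
  with simple_sub_mind := Minimality for simple_sub Sort Prop.
Combined Scheme simple_mutind from simple_kind_mind, simple_ty_mind,
  simple_neu_mind, simple_tm_mind, simple_ctx_mind, simple_sub_mind.

Scheme hs_kind_mind := Minimality for hs_kind Sort Prop
  with hs_ctx_mind := Minimality for hs_ctx Sort Prop.
Combined Scheme hs_kind_ctx_mind from hs_kind_mind, hs_ctx_mind.

Scheme kind_ind_ctx := Induction for kind Sort Prop
  with ctx_ind_kind := Induction for ctx Sort Prop.
Combined Scheme kind_ctx_ind from kind_ind_ctx, ctx_ind_kind.

(** * Erasure and weakening *)

Lemma length_entries (psi : sctx M) : length (entries psi) = length (shat psi).
Proof. induction psi; simpl; congruence. Qed.

Lemma shat_erase_ctx (Psi : ctx M) : shat (erase_ctx Psi) = hat Psi.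
Proof. induction Psi; simpl; congruence. Qed.

Lemma length_entries_erase (Psi : ctx M) :
  length (entries (erase_ctx Psi)) = ctx_len Psi.
Proof. now rewrite length_entries, shat_erase_ctx. Qed.

(** Erased kinds and contexts contain no variables that lifting could renumber. *)
Lemma erase_lift :
  (forall (K : kind M) c d, erase_kind (lift_kind c d K) = erase_kind K) /\
  (forall (Psi : ctx M) c d, erase_ctx (lift_ctx c d Psi) = erase_ctx Psi).
Proof. apply kind_ctx_ind; intros; simpl; congruence. Qed.

(** Substitution only changes the types inside kinds and contexts, and erasure discards these. Hence
    a binder extends the environment by the same entries before and after substitution. *)
Lemma erase_hs :
  (forall gamma sigma d (K K' : kind M), hs_kind gamma sigma d K K' ->
    erase_kind K' = erase_kind K) /\
  (forall gamma sigma d (Psi Psi' : ctx M), hs_ctx gamma sigma d Psi Psi' ->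
    erase_ctx Psi' = erase_ctx Psi).
Proof. apply hs_kind_ctx_mind; intros; simpl; congruence. Qed.

(** Insertion of [d] entries at position [c], expressed through lookups so that nothing has to be
    said about the inserted entries. *)
Definition weakens (c d : nat) (E E' : senv) : Prop :=
  forall i x, nth_error E i = Some x ->
    nth_error E' (if c <=? i then d + i else i) = Some x.

Lemma weakens_app (F E E' : senv) (c d : nat) :
  weakens c d E E' -> weakens (length F + c) d (F ++ E) (F ++ E').
Proof.
  intros H i x Hi.
  destruct (Nat.lt_ge_cases i (length F)) as [Hlt|Hge].
  - destruct (Nat.leb_spec (length F + c) i); [lia|].
    now rewrite nth_error_app1 in * by lia.
  - rewrite nth_error_app2 in Hi by lia. apply H in Hi.
    destruct (Nat.leb_spec c (i - length F)), (Nat.leb_spec (length F + c) i);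
      try lia; rewrite nth_error_app2 by lia; rewrite <- Hi; f_equal; lia.
Qed.

Lemma weakens_prefix (B E : senv) : weakens 0 (length B) E (B ++ E).
Proof.
  intros i x Hi; simpl.
  rewrite nth_error_app2 by lia. rewrite <- Hi; f_equal; lia.
Qed.

(** Replacing a variable below [d] binders inserts a lifted type or term, which must remain simple.
    The cutoff is general because it grows under binders. *)
Lemma simple_lift :
  (forall E (K : kind M), simple_kind E K ->
    forall c d E', weakens c d E E' -> simple_kind E' (lift_kind c d K)) /\
  (forall E (A : ty M) kappa, simple_ty E A kappa ->
    forall c d E', weakens c d E E' -> simple_ty E' (lift_ty c d A) kappa) /\
  (forall E (P : neu M) kappa, simple_neu E P kappa ->
    forall c d E', weakens c d E E' -> simple_neu E' (lift_neu c d P) kappa) /\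
  (forall E (e : tm M), simple_tm E e ->
    forall c d E', weakens c d E E' -> simple_tm E' (lift_tm c d e)) /\
  (forall E (Psi : ctx M), simple_ctx E Psi ->
    forall c d E', weakens c d E E' -> simple_ctx E' (lift_ctx c d Psi)) /\
  (forall E (sigma : sub M) psi, simple_sub E sigma psi ->
    forall c d E', weakens c d E E' -> simple_sub E' (lift_sub c d sigma) psi).
Proof.
  destruct erase_lift as [Ek Ec].
  apply simple_mutind; intros; simpl; try econstructor; eauto;
    rewrite ?Ek, ?Ec, <- ?length_entries_erase, <- ?length_entries;
    auto using weakens_app;
    match goal with
    | IH : forall c d E', weakens c d (?x :: ?E) E' -> _, H : weakens _ _ ?E _ |- _ =>
        apply IH; exact (weakens_app [x] _ _ _ _ H)
    end.
Qed.

(** * Definedness of hereditary substitution *)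

(** The termination measure. The successor at [SKUp] makes the bound context strictly smaller than
    the kind; term variables count nothing because replacing one starts no further substitution. *)
Fixpoint skind_size (kappa : skind M) : nat :=
  match kappa with
  | SKType _ => 1
  | SKUp _ _ psi kappa => S (sctx_size psi + skind_size kappa)
  end
with sctx_size (psi : sctx M) : nat :=
  match psi with
  | XNil => 0
  | XTy psi kappa => sctx_size psi + skind_size kappa
  | XTm psi => sctx_size psi
  end.

Lemma simple_sub_len E (sigma : sub M) psi :
  simple_sub E sigma psi -> sub_len sigma = length (entries psi).
Proof. induction 1; simpl; congruence. Qed.

(** The size bound holds because each kind is a summand of the size of its context; it is what later
    makes nested substitutions smaller. *)
Lemma simple_sub_ty_at E (sigma : sub M) psi j kappa :
  simple_sub E sigma psi -> nth_error (entries psi) j = Some (Some kappa) ->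
  exists A, sub_ty_at sigma j = Some A /\ sctx_kind_at psi j = Some kappa /\
    simple_ty E A kappa /\ skind_size kappa <= sctx_size psi.
Proof.
  intros Hs; revert j; induction Hs; intros [|j] Hj; simpl in *; try discriminate.
  - injection Hj as ->. exists A; repeat split; auto; lia.
  - destruct (IHHs j Hj) as (A' & ? & ? & ? & ?).
    exists A'; repeat split; auto; lia.
  - destruct (IHHs j Hj) as (A' & ? & ? & ? & ?).
    exists A'; repeat split; auto; lia.
Qed.

Lemma simple_sub_tm_at E (sigma : sub M) psi j :
  simple_sub E sigma psi -> nth_error (entries psi) j = Some None ->
  exists e, sub_tm_at sigma j = Some e /\ simple_tm E e.
Proof.
  intros Hs; revert j; induction Hs; intros [|j] Hj; simpl in *; try discriminate;
    eauto.
Qed.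

(** [B] lists the [d] binders crossed and [S] is the environment in which the entries of [sigma]
    live; the domain of [sigma] sits between them. *)
Definition substitutes (gamma : sctx M) (sigma : sub M) (d : nat) (E E' : senv)
    : Prop :=
  exists B S, d = length B /\ E = B ++ entries gamma ++ S /\ E' = B ++ S /\
    simple_sub S sigma gamma.

Lemma substitutes_app F gamma sigma d E E' :
  substitutes gamma sigma d E E' ->
  substitutes gamma sigma (length F + d) (F ++ E) (F ++ E').
Proof.
  intros (B & S & -> & -> & -> & H). exists (F ++ B), S.
  now rewrite length_app, !app_assoc.
Qed.

Lemma substitutes_cons x gamma sigma d E E' :
  substitutes gamma sigma d E E' ->
  substitutes gamma sigma (S d) (x :: E) (x :: E').
Proof. exact (substitutes_app [x] gamma sigma d E E'). Qed.

Lemma substitutes_entries psi gamma sigma d E E' :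
  substitutes gamma sigma d E E' ->
  substitutes gamma sigma (length (shat psi) + d)
    (entries psi ++ E) (entries psi ++ E').
Proof. rewrite <- length_entries. apply substitutes_app. Qed.

Lemma substitutes_ctx Psi gamma sigma d E E' :
  substitutes gamma sigma d E E' ->
  substitutes gamma sigma (ctx_len Psi + d)
    (entries (erase_ctx Psi) ++ E) (entries (erase_ctx Psi) ++ E').
Proof. rewrite <- length_entries_erase. apply substitutes_app. Qed.

(** The cases mirror the three variable rules of hereditary substitution. *)
Inductive var_position (gamma : sctx M) (sigma : sub M) (d : nat) (E' : senv)
    (x : option (skind M)) : nat -> Prop :=
| var_bound i :
    i < d -> nth_error E' i = Some x -> var_position gamma sigma d E' x i
| var_dom j S B :
    d = length B -> E' = B ++ S -> simple_sub S sigma gamma ->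
    nth_error (entries gamma) j = Some x ->
    var_position gamma sigma d E' x (d + j)
| var_free j :
    nth_error E' (d + j) = Some x ->
    var_position gamma sigma d E' x (d + sub_len sigma + j).

Lemma substitutes_var gamma sigma d E E' i x :
  substitutes gamma sigma d E E' -> nth_error E i = Some x ->
  var_position gamma sigma d E' x i.
Proof.
  intros (B & S & -> & -> & -> & H) Hi.
  pose proof (simple_sub_len _ _ _ H) as Hl.
  destruct (Nat.lt_ge_cases i (length B)).
  { rewrite nth_error_app1 in Hi by lia.
    apply var_bound; [lia|]. now rewrite nth_error_app1 by lia. }
  rewrite nth_error_app2 in Hi by lia.
  destruct (Nat.lt_ge_cases (i - length B) (length (entries gamma))).
  - rewrite nth_error_app1 in Hi by lia.
    replace i with (length B + (i - length B)) by lia.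
    eapply var_dom; eauto.
  - rewrite nth_error_app2 in Hi by lia.
    replace i with (length B + sub_len sigma +
      (i - length B - length (entries gamma))) by lia.
    apply var_free. rewrite nth_error_app2 by lia.
    rewrite <- Hi; f_equal; lia.
Qed.

(** The kind of a type returned at the head of a neutral descends from a kind in [gamma]. The size
    bound records this and is the invariant that justifies nested substitutions. *)
Definition simple_result (E : senv) (gamma : sctx M) (kappa : skind M)
    (r : neu_result M) : Prop :=
  match r with
  | RTy A kappa' =>
      kappa' = kappa /\ simple_ty E A kappa /\ skind_size kappa <= sctx_size gamma
  | RNeu Q => simple_neu E Q kappa
  end.

(** Restricted to types at depth 0, the only kind of nested substitution that the rules ever
    start. *)
Definition hs_ty_total (gamma : sctx M) : Prop :=
  forall E sigma A kappa, simple_sub E sigma gamma ->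
    simple_ty (entries gamma ++ E) A kappa ->
    exists A', hs_ty gamma sigma 0 A A' /\ simple_ty E A' kappa.

(** Inner induction on the simple kinding derivation, under the outer hypothesis for smaller
    domains. Simplicity of the results is proved along with existence, since the results for the
    parts of a splice are fed into the nested substitution. *)
Lemma hs_defined_step (gamma : sctx M) :
  (forall psi, sctx_size psi < sctx_size gamma -> hs_ty_total psi) ->
  (forall E (K : kind M), simple_kind E K ->
    forall sigma d E', substitutes gamma sigma d E E' ->
    exists K', hs_kind gamma sigma d K K' /\ simple_kind E' K') /\
  (forall E (A : ty M) kappa, simple_ty E A kappa ->
    forall sigma d E', substitutes gamma sigma d E E' ->
    exists A', hs_ty gamma sigma d A A' /\ simple_ty E' A' kappa) /\
  (forall E (P : neu M) kappa, simple_neu E P kappa ->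
    forall sigma d E', substitutes gamma sigma d E E' ->
    exists r, hs_neu gamma sigma d P r /\ simple_result E' gamma kappa r) /\
  (forall E (e : tm M), simple_tm E e ->
    forall sigma d E', substitutes gamma sigma d E E' ->
    exists e', hs_tm gamma sigma d e e' /\ simple_tm E' e') /\
  (forall E (Psi : ctx M), simple_ctx E Psi ->
    forall sigma d E', substitutes gamma sigma d E E' ->
    exists Psi', hs_ctx gamma sigma d Psi Psi' /\ simple_ctx E' Psi') /\
  (forall E (tau : sub M) psi, simple_sub E tau psi ->
    forall sigma d E', substitutes gamma sigma d E E' ->
    exists tau', hs_sub gamma sigma d tau tau' /\ simple_sub E' tau' psi).
Proof.
  intros IHgamma.
  destruct erase_hs as [Ek Ec].
  destruct simple_lift as (_ & Lty & _ & Ltm & _).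
  apply simple_mutind.
  all: intros;
    repeat match goal with
    | IH : forall sigma d E', substitutes _ _ _ (entries (erase_ctx ?Psi) ++ ?E) _ -> _,
      H : substitutes _ _ _ ?E _ |- _ =>
        specialize (IH _ _ _ (substitutes_ctx Psi _ _ _ _ _ H))
    | IH : forall sigma d E', substitutes _ _ _ (entries ?psi ++ ?E) _ -> _,
      H : substitutes _ _ _ ?E _ |- _ =>
        specialize (IH _ _ _ (substitutes_entries psi _ _ _ _ _ H))
    | IH : forall sigma d E', substitutes _ _ _ (?x :: ?E) _ -> _,
      H : substitutes _ _ _ ?E _ |- _ =>
        specialize (IH _ _ _ (substitutes_cons x _ _ _ _ _ H))
    | IH : forall sigma d E', substitutes _ _ _ ?E _ -> _,
      H : substitutes _ _ _ ?E _ |- _ =>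
        specialize (IH _ _ _ H)
    end.
  all: repeat match goal with
    | H : exists _, _ |- _ => destruct H as (? & ? & ?)
    end.
  (* Erasure is unchanged by substitution, so results under binders live in the right environments.
     Each hypothesis is reverted to keep the loop from revisiting it. *)
  all: repeat match goal with
    | H : hs_ctx _ _ _ _ _ |- _ => apply Ec in H as ?; revert H
    | H : hs_kind _ _ _ _ _ |- _ => apply Ek in H as ?; revert H
    end; intros.
  all: try (eexists; split; [now econstructor; eauto|];
    econstructor; eauto; congruence).
  - destruct x as [A kappa'|Q].
    + destruct H2 as (-> & ? & _). exists A; split; auto. eapply hs_TNeu_ty; eauto.
    + exists (TNeu Q); split; [now apply hs_TNeu_neu|now constructor].
  - destruct (substitutes_var _ _ _ _ _ _ _ H0 H) as [i|j S B -> -> Hs Hj|j].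
    + exists (RNeu (NVar i)); split; [now constructor|simpl; now constructor].
    + destruct (simple_sub_ty_at _ _ _ _ _ Hs Hj) as (A & ? & ? & ? & ?).
      exists (RTy (lift_ty 0 (length B) A) kappa).
      split; [now constructor|].
      repeat split; eauto using weakens_prefix.
    + exists (RNeu (NVar (d + j))); split; [now constructor|simpl; now constructor].
  - match goal with
    | H : hs_neu _ _ _ P ?r, H' : simple_result _ _ _ ?r |- _ =>
        destruct r as [A kappa'|Q]; [destruct H' as (-> & HA & Hsize)|simpl in H']
    end.
    (* Only neutral types and quotations can have a kind [SKUp]. *)
    + simpl in Hsize. inversion HA; subst.
      * eexists (RNeu _); split; [eapply hs_NSplice_tyneu; eauto|].
        simpl; econstructor; eauto.
      (* [Hsize] bounds the whole [SKUp] kind, so [psi] is strictly smaller than [gamma] and the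
         outer hypothesis applies. *)
      * match goal with
        | Hs : simple_sub E' _ psi, HA0 : simple_ty (entries psi ++ E') _ kappa |- _ =>
            destruct (IHgamma psi ltac:(lia) _ _ _ _ Hs HA0) as (A' & ? & ?)
        end.
        exists (RTy A' kappa); split; [eapply hs_NSplice_quote; eauto|].
        repeat split; auto; lia.
    + eexists (RNeu _); split; [eapply hs_NSplice_neu; eauto|].
      simpl; econstructor; eauto.
  - destruct (substitutes_var _ _ _ _ _ _ _ H0 H) as [i|j S B -> -> Hs Hj|j].
    + exists (Var i); split; now constructor.
    + destruct (simple_sub_tm_at _ _ _ _ Hs Hj) as (e & ? & ?).
      exists (lift_tm 0 (length B) e); split; [now constructor|].
      eauto using weakens_prefix.
    + exists (Var (d + j)); split; now constructor.
Qed.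

Lemma substitutes_sub E gamma sigma :
  simple_sub E sigma gamma -> substitutes gamma sigma 0 (entries gamma ++ E) E.
Proof. intros H. now exists [], E. Qed.

Lemma hs_ty_defined (gamma : sctx M) : hs_ty_total gamma.
Proof.
  induction gamma as [gamma IH] using (well_founded_induction
    (Wf_nat.well_founded_ltof _ sctx_size)).
  intros E sigma A kappa Hs HA.
  destruct (hs_defined_step gamma IH) as (_ & Hty & _).
  eauto using substitutes_sub.
Qed.

(** The form in which redexes use the result: no binder has been crossed yet. *)
Lemma hs_tm_defined E (gamma : sctx M) sigma e :
  simple_sub E sigma gamma -> simple_tm (entries gamma ++ E) e ->
  exists e', hs_tm gamma sigma 0 e e'.
Proof.
  intros Hs He.
  destruct (hs_defined_step gamma (fun psi _ => hs_ty_defined psi))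
    as (_ & _ & _ & Htm & _).
  destruct (Htm _ _ He _ _ _ (substitutes_sub _ _ _ Hs)) as (e' & ? & _); eauto.
Qed.

(** * From typing to simple kinding *)

Definition erase_decl (D : decl M) : option (skind M) :=
  match D with DTy _ K => Some (erase_kind K) | DTm _ _ => None end.

(* Resources are forgotten: [E] may declare more than [Gamma], in particular
   fill its holes. *)
Definition extends (E : senv) (Gamma : env M) : Prop :=
  forall i D, declares Gamma i D -> nth_error E i = Some (erase_decl D).

Lemma extends_app Gamma E Psi :
  extends E Gamma -> extends (entries (erase_ctx Psi) ++ E) (env_app Gamma Psi).
Proof.
  intros H; induction Psi; simpl; auto;
    intros [|i] D HD; try (now injection HD as <-); now apply IHPsi.
Qed.

Lemma extends_cons Gamma E D :
  extends E Gamma -> extends (erase_decl D :: E) (Some D :: Gamma).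
Proof.
  intros H [|i] D' HD; [now injection HD as <-|now apply H].
Qed.

Lemma split_declares (Gamma1 Gamma2 Gamma : env M) :
  split Gamma1 Gamma2 Gamma -> forall i D,
  declares Gamma1 i D \/ declares Gamma2 i D -> declares Gamma i D.
Proof.
  unfold declares.
  induction 1; intros [|i] D; simpl; auto; intros []; auto; discriminate.
Qed.

(** A split only hides declarations, so one simple environment serves both sides. *)
Lemma extends_split_l Gamma1 Gamma2 Gamma E :
  split Gamma1 Gamma2 Gamma -> extends E Gamma -> extends E Gamma1.
Proof. intros Hs H i D HD; eauto using split_declares. Qed.

Lemma extends_split_r Gamma1 Gamma2 Gamma E :
  split Gamma1 Gamma2 Gamma -> extends E Gamma -> extends E Gamma2.
Proof. intros Hs H i D HD; eauto using split_declares. Qed.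

Scheme wf_kind_mind := Minimality for wf_kind Sort Prop
  with has_kind_mind := Minimality for has_kind Sort Prop
  with wf_ctx_mind := Minimality for wf_ctx Sort Prop
  with has_type_mind := Minimality for has_type Sort Prop
  with has_sub_mind := Minimality for has_sub Sort Prop.
Combined Scheme typing_mutind from wf_kind_mind, has_kind_mind, wf_ctx_mind,
  has_type_mind, has_sub_mind.

Lemma weakens_cons x E : weakens 0 1 E (x :: E).
Proof. exact (weakens_prefix [x] E). Qed.

Lemma simple_ty_lift1 x E A kappa :
  simple_ty E A kappa -> simple_ty (x :: E) (lift_ty 0 1 A) kappa.
Proof. intros H. eapply simple_lift; eauto using weakens_cons. Qed.

Lemma simple_ty_neu E P kappa :
  simple_ty E (TNeu P) kappa -> simple_neu E P kappa.
Proof. now inversion 1. Qed.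

(* The presupposition that [A] is well formed is kept for [has_type]: without
   it nothing is known about the annotations of abstractions. *)
Lemma typing_simple :
  (forall Gamma k (K : kind M), wf_kind Gamma k K ->
    forall E, extends E Gamma -> simple_kind E K) /\
  (forall Gamma k (A : ty M) K, has_kind Gamma k A K ->
    forall E, extends E Gamma -> simple_ty E A (erase_kind K)) /\
  (forall Gamma : env M, wf_ctx Gamma ->
    forall Gamma0 Psi E, Gamma = env_app Gamma0 Psi -> extends E Gamma0 ->
    simple_ctx E Psi) /\
  (forall Gamma k (e : tm M) A, has_type Gamma k e A ->
    forall E, extends E Gamma -> simple_ty E A (SKType k) -> simple_tm E e) /\
  (forall Gamma (sigma : sub M) Psi, has_sub Gamma sigma Psi ->
    forall E, extends E Gamma -> simple_sub E sigma (erase_ctx Psi)).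
Proof.
  destruct erase_hs as [Ek _]. destruct erase_lift as [El _].
  apply typing_mutind; simpl; intros;
    repeat match goal with
    | H : split ?G1 ?G2 ?G, HE : extends ?E ?G |- _ =>
        pose proof (extends_split_l _ _ _ _ H HE);
        pose proof (extends_split_r _ _ _ _ H HE); clear H
    end;
    (* A kind obtained by substitution has the erasure of the original one, so dependency disappears
       here. *)
    repeat match goal with
    | H : hs_kind _ _ _ _ _ |- _ => apply Ek in H
    end.
  all: try rewrite El; try (rewrite <- shat_erase_ctx).
  (* A well-formed context is read as a prefix followed by [Psi]: an empty [Psi] is trivial,
     otherwise the head declaration is the last one of [Psi]. *)
  all: try match goal with
    | H : _ :: _ = env_app _ ?Psi |- _ =>
      destruct Psi; [constructor|simpl in H; try discriminate; injection H as -> ..]; subst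
    | H : _ = env_app _ ?Psi |- _ =>
      destruct Psi; [constructor|simpl in H; try discriminate ..]
    end.
  (* Simple kinding of the type of an introduction form is inverted to reach its components,
     annotations included. *)
  all: match goal with
    | H : simple_ty _ (TUp _ _ _ _) _ |- simple_tm _ (Quote _ _ _ _) => inversion H; subst
    | H : simple_ty _ (TDown _ _ _) _ |- simple_tm _ (Store _ _ _) => inversion H; subst
    | H : simple_ty _ (TForall _ _ _) _ |- simple_tm _ (TLam _ _ _) => inversion H; subst
    | H : simple_ty _ (TLolli _ _) _ |- simple_tm _ (Lam _ _ _) => inversion H; subst
    | _ => idtac end.
  all: try solve [econstructor; eauto using extends_app, extends_cons, simple_ty_lift1].
  - do 2 constructor.
    match goal with Hi : declares ?G i _, HE : extends _ ?G |- _ =>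
      exact (HE _ _ Hi) end.
  - constructor.
    match goal with H : erase_kind _ = erase_kind _ |- _ => rewrite H end.
    econstructor; eauto using simple_ty_neu.
  (* The declared kind is formed over one side of a split; an environment for the whole context also
     extends that side. *)
  - match goal with IH : forall _ _ _, _ = env_app _ _ -> _ |- _ =>
      constructor; [eauto|] end.
    eauto using extends_app, extends_split_l.
  - constructor; [eauto|].
    eauto using extends_app, extends_split_l.
  - constructor.
    match goal with H : singleton_env _ _ _ |- _ => destruct H as [H _] end.
    match goal with Hi : declares ?G i _, HE : extends _ ?G |- _ =>
      exact (HE _ _ Hi) end.
  - constructor; [eauto|].
    match goal with H : erase_kind _ = erase_kind _ |- _ => rewrite <- H end; eauto.
Qed.

(** * Canonical forms *)

(** A non-neutral weak normal form is an introduction form, and its type tells which one. Typing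
    also fixes the modes on the constructor, which the reduction rules require to match. The neutral
    alternative remains because terms may be open. *)
Lemma wnf_up Gamma n m k Psi (e : tm M) A :
  has_type Gamma n e (TUp m k Psi A) -> wnf e ->
  wneu e \/ exists a, e = Quote n k (hat Psi) a /\ template n a /\
    has_type (env_app Gamma Psi) k a A.
Proof.
  intros Ht Hw; inversion Hw; subst; auto; inversion Ht; subst; eauto.
Qed.

Lemma wnf_down Gamma n m k (e : tm M) A :
  has_type Gamma n e (TDown m k A) -> wnf e ->
  wneu e \/ exists v, e = Store m n v /\ wnf v.
Proof.
  intros Ht Hw; inversion Hw; subst; auto; inversion Ht; subst; eauto.
Qed.

Lemma wnf_forall Gamma k m K (e : tm M) A :
  has_type Gamma k e (TForall m K A) -> wnf e ->
  wneu e \/ exists f, e = TLam m K f.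
Proof.
  intros Ht Hw; inversion Hw; subst; auto; inversion Ht; subst; eauto.
Qed.

Lemma wnf_lolli Gamma k (e : tm M) A B :
  has_type Gamma k e (TLolli A B) -> wnf e ->
  wneu e \/ exists f, e = Lam k A f.
Proof.
  intros Ht Hw; inversion Hw; subst; auto; inversion Ht; subst; eauto.
Qed.

(** * Progress *)

(** Both claims need a joint induction: a quotation evaluates by template reduction of its body, and
    template reduction returns to evaluation at sufficiently high modes. Simple kinding of [A] in
    [E] replaces the presuppositions, as it passes easily to binders and splits. *)
Lemma progress Gamma k (e : tm M) A :
  has_type Gamma k e A ->
  forall E, extends E Gamma -> simple_ty E A (SKType k) ->
  ((exists e', step e e') \/ wnf e) /\
  (forall m : M, (exists e', tstep m e e') \/ template m e).
Proof.
  destruct typing_simple as (_ & Hkind & _ & Htype & Hsub).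
  induction 1 as
    [| |Gamma k l Psi e A He IHe
     |Gamma1 Gamma2 Gamma m k Psi e sigma A A' Hsplit _ _ _ Hup He IHe Hsigma Hs
     |Gamma1 GammaW Gamma m k e A Hsplit _ _ _ He IHe
     |Gamma1 Gamma2 Gamma m n k e f A B Hsplit _ _ _ _ Hdown He IHe Hf IHf
     |Gamma m k K e A He IHe
     |Gamma k A e B He IHe
     |Gamma1 Gamma2 Gamma m k K e A B B' Hsplit _ _ _ Hall He IHe _ HA HB
     |Gamma1 Gamma2 Gamma k e f A B Hsplit _ _ Hlolli He IHe HA Hf IHf];
    intros E HE Hpre.
  - split; [right; do 2 constructor|right; constructor].
  - split; [right; constructor|right; constructor].
  - inversion Hpre; subst.
    destruct (IHe _ (extends_app _ _ Psi HE)) as [_ IH]; auto.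
    split.
    (* Evaluation reduces the body as a template in the quotation's own mode. *)
    + destruct (IH k) as [[e' ?]|?]; [left|right; constructor; auto].
      eexists; constructor; eauto.
    + intros n; destruct (IH n) as [[e' ?]|?]; [left|right; constructor; auto].
      eexists; constructor; eauto.
  - pose proof (extends_split_l _ _ _ _ Hsplit HE) as HE1.
    pose proof (extends_split_r _ _ _ _ Hsplit HE) as HE2.
    specialize (Hkind _ _ _ _ Hup _ HE1) as Hpre1.
    destruct (IHe _ HE1 Hpre1) as [IHstep IHt].
    (* The substitution and the quoted body are typed over different sides of the split, but both
       are simple over the same [E]. *)
    assert (Hredex : forall a, has_type (env_app Gamma1 Psi) k a A ->
      exists a', hs_tm (erase_ctx Psi) sigma 0 a a').
    { intros a Ha. eapply hs_tm_defined; [eapply Hsub; eauto|].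
      eapply Htype; eauto using extends_app. now inversion Hpre1. }
    split.
    + destruct IHstep as [[e' ?]|Hw]; [left; eexists; constructor; eauto|].
      destruct (wnf_up _ _ _ _ _ _ _ He Hw) as [?|(a & -> & Ha & Hta)];
        [right; do 2 constructor; auto|left].
      destruct (Hredex a Hta) as [a' ?]. exists a'.
      (* The redex rule expects the binder list computed from the erased domain, while typing yields
         [hat Psi]. *)
      rewrite <- shat_erase_ctx. now constructor.
    (* The preorder on modes is not assumed decidable, so the comparison is classical. *)
    + intros n. destruct (classic (mode_ge m n)) as [Hge|Hge].
      * destruct IHstep as [[e' ?]|Hw];
          [left; eexists; eapply tstep_Splice_above; eauto|].
        destruct (wnf_up _ _ _ _ _ _ _ He Hw) as [?|(a & -> & Ha & Hta)];
          [right; now apply tpl_Splice_above|left].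
        destruct (Hredex a Hta) as [a' ?]. exists a'.
        rewrite <- shat_erase_ctx. now constructor.
      * destruct (IHt n) as [[e' ?]|?];
          [left; eexists; eapply tstep_Splice_below; eauto|].
        right; now apply tpl_Splice_below.
  - pose proof (extends_split_l _ _ _ _ Hsplit HE) as HE1.
    inversion Hpre; subst.
    destruct (IHe _ HE1) as [IHstep IHt]; auto.
    split.
    + destruct IHstep as [[e' ?]|?]; [left; eexists; constructor; eauto|].
      right; now constructor.
    + intros n. destruct (classic (mode_ge m n)) as [Hge|Hge].
      * destruct IHstep as [[e' ?]|?];
          [left; eexists; eapply tstep_Store_above; eauto|].
        right; now apply tpl_Store_above.
      * destruct (IHt n) as [[e' ?]|?];
          [left; eexists; eapply tstep_Store_below; eauto|].
        right; now apply tpl_Store_below.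
  - pose proof (extends_split_l _ _ _ _ Hsplit HE) as HE1.
    pose proof (extends_split_r _ _ _ _ Hsplit HE) as HE2.
    apply (extends_cons _ _ (DTm m A)) in HE2.
    specialize (Hkind _ _ _ _ Hdown _ HE1) as Hpre1.
    destruct (IHe _ HE1 Hpre1) as [IHstep IHt].
    (* The body has type [B] lifted over the loaded variable, whose simple declaration is [None]. *)
    apply (simple_ty_lift1 None) in Hpre.
    destruct (IHf _ HE2 Hpre) as [_ IHtf].
    split.
    + destruct IHstep as [[e' ?]|Hw]; [left; eexists; constructor; eauto|].
      destruct (wnf_down _ _ _ _ _ _ He Hw) as [?|(v & -> & Hv)];
        [right; do 2 constructor; auto|left].
      assert (Htv : simple_tm E v).
      { pose proof (Htype _ _ _ _ He _ HE1 Hpre1) as Hst. now inversion Hst. }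
      destruct (hs_tm_defined E (XTm XNil) (STm SNil m v) f) as [f' ?];
        [repeat constructor; auto|simpl; eapply Htype; eauto|].
      exists f'; now constructor.
    + intros p. destruct (classic (mode_ge n p)) as [Hge|Hge].
      * destruct IHstep as [[e' ?]|?];
          [left; eexists; eapply tstep_Load_above; eauto|].
        destruct (IHtf p) as [[f' ?]|?];
          [left; eexists; eapply tstep_Load_body_above; eauto|].
        right; now apply tpl_Load_above.
      * destruct (IHt p) as [[e' ?]|?];
          [left; eexists; eapply tstep_Load_below; eauto|].
        destruct (IHtf p) as [[f' ?]|?];
          [left; eexists; eapply tstep_Load_body_below; eauto|].
        right; now apply tpl_Load_below.
  - split; [right; constructor|].
    inversion Hpre; subst.
    destruct (IHe _ (extends_cons _ _ (DTy m K) HE)) as [_ IH]; auto.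
    intros n; destruct (IH n) as [[e' ?]|?]; [left|right; constructor; auto].
    eexists; constructor; eauto.
  - split; [right; constructor|].
    inversion Hpre; subst.
    destruct (IHe _ (extends_cons _ _ (DTm k A) HE)) as [_ IH];
      [now apply simple_ty_lift1|].
    intros n; destruct (IH n) as [[e' ?]|?]; [left|right; constructor; auto].
    eexists; constructor; eauto.
  - pose proof (extends_split_l _ _ _ _ Hsplit HE) as HE1.
    specialize (Hkind _ _ _ _ Hall _ HE) as Hpre1.
    destruct (IHe _ HE Hpre1) as [IHstep IHt].
    split.
    + destruct IHstep as [[e' ?]|Hw]; [left; eexists; constructor; eauto|].
      destruct (wnf_forall _ _ _ _ _ _ He Hw) as [?|(f & ->)];
        [right; do 2 constructor; auto|left].
      pose proof (Htype _ _ _ _ He _ HE Hpre1) as Hst.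
      inversion Hst; subst.
      destruct (hs_tm_defined E (XTy XNil (erase_kind K)) (STy SNil m A) f)
        as [f' ?]; [repeat constructor; eauto|auto|].
      exists f'; now constructor.
    (* Template reduction never contracts this redex: if the head is a template, so is the
       application. *)
    + intros n. destruct (IHt n) as [[e' ?]|?]; [left|right; constructor; auto].
      eexists; constructor; eauto.
  - pose proof (extends_split_l _ _ _ _ Hsplit HE) as HE1.
    pose proof (extends_split_r _ _ _ _ Hsplit HE) as HE2.
    specialize (Hkind _ _ _ _ Hlolli _ HE1) as Hpre1.
    specialize (Hkind _ _ _ _ HA _ HE2) as Hpre2.
    destruct (IHe _ HE1 Hpre1) as [IHstep IHt].
    destruct (IHf _ HE2 Hpre2) as [IHfstep IHft].
    split.
    + destruct IHstep as [[e' ?]|Hw]; [left; eexists; apply step_App_l; eauto|].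
      destruct IHfstep as [[f' ?]|Hv]; [left; eexists; apply step_App_r; eauto|].
      destruct (wnf_lolli _ _ _ _ _ He Hw) as [?|(g & ->)];
        [right; do 2 constructor; auto|left].
      pose proof (Htype _ _ _ _ He _ HE1 Hpre1) as Hst.
      inversion Hst; subst.
      destruct (hs_tm_defined E (XTm XNil) (STm SNil k f) g)
        as [g' ?]; [repeat constructor; eauto|auto|].
      exists g'; now constructor.
    + intros n. destruct (IHt n) as [[e' ?]|?];
        [left; eexists; apply tstep_App_l; eauto|].
      destruct (IHft n) as [[f' ?]|?];
        [left; eexists; apply tstep_App_r; eauto|].
      right; now constructor.
Qed.

(** A hole becomes a dummy term variable: this preserves the indices, and [extends] constrains only
    actual declarations. *)
Definition senv_of (Gamma : env M) : senv :=
  map (fun D => match D with Some D => erase_decl D | None => None end) Gamma.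

Lemma extends_senv_of Gamma : extends (senv_of Gamma) Gamma.
Proof.
  intros i D HD. unfold senv_of, declares in *.
  now rewrite nth_error_map, HD.
Qed.

End Simple.

Theorem theorem3p9 (M : mode_spec) (Gamma : env M) (k : M) (e : tm M) (A : ty M)
    (wf_Gamma : wf_ctx Gamma) (ge_Gamma : env_ge Gamma k)
    (wf_A : has_kind Gamma k A (KType k)) (e_typed : has_type Gamma k e A) :
  ((exists e', step e e') \/ wnf e) /\
  (forall m : M, (exists e', tstep m e e') \/ template m e).
Proof.
  eapply progress; eauto using extends_senv_of.
  destruct (typing_simple (M := M)) as (_ & Hkind & _).
  exact (Hkind _ _ _ _ wf_A _ (extends_senv_of Gamma)).
Qed.
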